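(* Let $G$ be a (possibly non-associative) algebra over an arbitrary field and let $N$ be a subspace of $G$ such that at least one of the following holds: (a) $N$ has finite codimension in $G$; (b) $N$ is a left ideal of $G$ and the factor module $G/N$ is Noetherian; (c) $N$ is a two-sided ideal of $G$ and the factor algebra $G/N$ satisfies the maximality condition (ascending chain condition) for two-sided ideals. Then $G$ contains characteristic subspaces $H_1, H_2, \ldots$ such that: 1. every $H_t$ is contained in (i.e. is an element of) the lattice of subspaces of $G$ generated by the images $\varphi(N)$ of $N$ under all automorphisms $\varphi$ of the algebra $G$; 2. for every $t$ and every multilinear element $w(x_1,\ldots,x_n)$ of degree $n\le t$ of a free (non-associative) algebra, the set $w(H_t,\ldots,H_t)$ is contained in the sum of a finite number of images of the set $w(N,\ldots,N)$ under automorphisms of $G$, i.e. there are $\varphi_1,\ldots,\varphi_k\in\mathrm{Aut}\, G$ with $$w(H_t,\ldots,H_t)\subseteq \varphi_1(w(N,\ldots,N))+\cdots+\varphi_k(w(N,\ldots,N));$$ 3. if $\mathrm{codim}$ is either the ordinary codimension of a subspace of $G$ (when $N$ has finite codimension), or a generalized $\mathrm{Aut}\,G$-codimension defined on the lattice of those ideals of $G$ whose factor modules (respectively, factor algebras) lie in $\mathcal F$, then $$\mathrm{codim}\, H_t\le f^{t-1}(\mathrm{codim}\, N),$$ where $f^k$ denotes the $k$-th iteration of the function $f(x)=x(x+1)$. Here, in case (b), the ideals in question are left ideals and $\mathcal F$ is the class of Noetherian modules; in case (c), the ideals are two-sided and $\mathcal F$ is the class of algebras satisfying the maximality condition for two-sided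 ideals.
   Context: A subspace of an algebra $G$ is characteristic if it is invariant under all automorphisms of $G$. For a left ideal $N$, $G/N$ is regarded as a left module over $G$ (its submodules correspond to the left ideals of $G$ containing $N$), so Noetherian means that the left ideals containing $N$ satisfy the ascending chain condition. A multilinear element $w(x_1,\ldots,x_n)$ of degree $n$ of a free (non-associative) algebra is a linear combination of non-associative monomials each of which contains each of $x_1,\ldots,x_n$ exactly once. For a subspace $H\subseteq G$, $w(H,\ldots,H)=\{w(h_1,\ldots,h_n): h_i\in H\}$ (the $h_i$ need not be different). The sum of subsets $X_1,\ldots,X_k$ of $G$ is $\{x_1+\cdots+x_k : x_i\in X_i\}$. A semilattice is a partially ordered set in which every finite subset $\mathcal N$ has a least upper bound $\sup\mathcal N$; it is directed if every finite subset has some lower bound, and Noetherian if it has no infinite strictly increasing chains. Lattices of subspaces or ideals are ordered by inclusion, with $\sup$ being the sum and greatest lower bound being the intersection. Generalized codimension: let $\mathcal L$ be a Noetherian directed semilattice and $\Phi\subseteq\mathrm{End}\,\mathcal L$ a semigroup of its endomorphisms. A function $\mathrm{codim}\colon\mathcal L\to\mathbb R$ is a generalized $\Phi$-codimension if: 1) $\mathrm{codim}\,N_1\le\mathrm{codim}\,N_2$ whenever $N_1\ge N_2$; 2) $\mathrm{codim}\,\varphi(N)\le\mathrm{codim}\,N$ for all $N\in\mathcal L$, $\varphi\in\Phi$; 3) for all $N_1,N_2\in\mathcal L$, $\mathrm{codim}\,\inf(N_1,N_2)\le\mathrm{codim}\,N_1+\mathrm{codim}\,N_2$ for some lower bound $\inf(N_1,N_2)$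 of $N_1$ and $N_2$; 4) in any family $\mathcal N\subseteq\mathcal L$ there are $r\le\max_{N\in\mathcal N}\mathrm{codim}\,N+1$ elements $N_1,\ldots,N_r$ such that $\sup\mathcal N=\sup(N_1,\ldots,N_r)$. Here $\mathrm{Aut}\,G$ acts on the lattice of ideals by $N\mapsto\varphi(N)$. *)

(* Defs.v *)
From HB Require Import structures.
From mathcomp Require Import all_boot all_order all_algebra.
From mathcomp Require Import all_classical all_reals ereal.
Set Implicit Arguments.
Unset Strict Implicit.
Unset Printing Implicit Defensive.
Import Order.TTheory GRing.Theory Num.Theory.
Local Open Scope classical_set_scope.
Local Open Scope ring_scope.

(* A semilattice is a subset [L] of an ambient poset [T] with the induced order,
   and a function on [L] is a function on [T] whose values outside [L] are
   never used. *)

Section Semilattices.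
Variables (d : Order.disp_t) (T : porderType d).

(* The least upper bound is taken among elements of [L]. *)
Definition lub_in (L X : set T) (s : T) : Prop :=
  [/\ L s, ubound X s & forall u, L u -> ubound X u -> (s <= u)%O].

(* Suprema are required for nonempty finite sets only: the ideals with
   Noetherian factors need not have a least element. *)
Record ndSemilattice := NdSemilattice {
  nd_carrier :> set T;
  nd_sup : forall X : set T, finite_set X -> X !=set0 -> X `<=` nd_carrier ->
    exists s, lub_in nd_carrier X s;
  nd_directed : forall X : set T, finite_set X -> X `<=` nd_carrier ->
    exists m, nd_carrier m /\ lbound X m;
  nd_noetherian :
    ~ exists C : nat -> T, forall n, nd_carrier (C n) /\ (C n < C n.+1)%O
}.

Definition semilattice_endo (L : set T) (phi : T -> T) : Prop :=
  (forall x, L x -> L (phi x)) /\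
  (forall X s, finite_set X -> X !=set0 -> X `<=` L ->
     lub_in L X s -> lub_in L (phi @` X) (phi s)).

Record endoSemigroup (L : set T) := EndoSemigroup {
  endo_carrier :> set (T -> T);
  endo_endo : forall phi, endo_carrier phi -> semilattice_endo L phi;
  endo_comp : forall phi psi, endo_carrier phi -> endo_carrier psi ->
    endo_carrier (phi \o psi)
}.

(* In the last condition the maximum over a possibly infinite family is the
   supremum in the extended reals ([+oo] for an unbounded family), the family is
   nonempty, and [r = 0] is allowed, the supremum of the empty family being the
   least element of [L]. *)
Record gen_codim (R : realType) (L : ndSemilattice) (Phi : endoSemigroup L)
    (codim : T -> R) : Prop := GenCodim {
  gen_codim_antitone : forall N1 N2, nd_carrier L N1 -> nd_carrier L N2 ->
    (N2 <= N1)%O -> codim N1 <= codim N2;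
  gen_codim_endo : forall phi N, endo_carrier Phi phi -> nd_carrier L N ->
    codim (phi N) <= codim N;
  gen_codim_inf : forall N1 N2, nd_carrier L N1 -> nd_carrier L N2 ->
    exists m, [/\ nd_carrier L m, (m <= N1)%O, (m <= N2)%O &
                  codim m <= codim N1 + codim N2];
  gen_codim_sup : forall F : set T, F `<=` L -> F !=set0 ->
    exists (r : nat) (M : 'I_r -> T),
      [/\ forall i, F (M i),
          ((r%:R)%:E <= ereal_sup [set (codim N)%:E | N in F] + 1%:E)%E &
          exists s, lub_in L F s /\ lub_in L (range M) s]
}.

End Semilattices.

Inductive na_monomial (n : nat) : Type :=
  | NaVar of 'I_n
  | NaMul of na_monomial n & na_monomial n.

Fixpoint na_vars (n : nat) (m : na_monomial n) : seq 'I_n :=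
  match m with
  | NaVar i => [:: i]
  | NaMul m1 m2 => na_vars m1 ++ na_vars m2
  end.

(* An element of the free algebra on [n] variables is presented as a finite list
   of terms (coefficient, monomial); it stands for the sum of its terms. *)
Definition free_elt (K : fieldType) (n : nat) := seq (K * na_monomial n).

Definition multilinear (K : fieldType) (n : nat) (w : free_elt K n) : bool :=
  all (fun p => [forall i, count_mem i (na_vars p.2) == 1%N]) w.

Section VectorSpace.
Variables (K : fieldType) (G : lmodType K).

Definition linear_subspace (A : set G) : Prop :=
  A 0 /\ forall (a : K) x y, A x -> A y -> A (a *: x + y).

(* [dim (G / N) = c]: some family of [c] vectors is a basis of [G] modulo [N]. *)
Definition has_codim (N : set G) (c : nat) : Prop :=
  exists v : 'I_c -> G,
    forall g, exists! a : 'rV[K]_c, N (g - \sum_i a ord0 i *: v i).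

Definition add_set (A B : set G) : set G := [set x + y | x in A & y in B].

Definition sum_sets (k : nat) (X : 'I_k -> set G) : set G :=
  [set \sum_i x i | x in [set x : 'I_k -> G | forall i, X i (x i)]].

Definition sublattice (S : set (set G)) : Prop :=
  forall A B, S A -> S B -> S (add_set A B) /\ S (A `&` B).

(* ACC for the members of [P] containing [N]. *)
Definition acc_above (P : set (set G)) (N : set G) : Prop :=
  forall C : nat -> set G,
    (forall i, [/\ P (C i), N `<=` C i & C i `<=` C i.+1]) ->
    exists m, forall i, (m <= i)%N -> C i = C m.

End VectorSpace.

(* A non-associative algebra over [K] is a [K]-module [G] with a bilinear
   product [mul]. *)
Section Algebra.
Variables (K : fieldType) (G : lmodType K) (mul : {bilinear G -> G -> G}).

Definition left_ideal (I : set G) : Prop :=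
  linear_subspace I /\ forall g x, I x -> I (mul g x).

Definition two_sided_ideal (I : set G) : Prop :=
  linear_subspace I /\ forall g x, I x -> I (mul g x) /\ I (mul x g).

(* Submodules of [G / N], resp. ideals of [G / N], are the left, resp. two-sided,
   ideals of [G] containing [N]. *)
Definition noeth_left_ideal (N : set G) : Prop :=
  left_ideal N /\ acc_above left_ideal N.

Definition max_two_sided_ideal (N : set G) : Prop :=
  two_sided_ideal N /\ acc_above two_sided_ideal N.

Definition automorphism (phi : G -> G) : Prop :=
  [/\ linear phi, bijective phi & forall x y, phi (mul x y) = mul (phi x) (phi y)].

Definition characteristic (H : set G) : Prop :=
  forall phi, automorphism phi -> phi @` H = H.

Definition aut_images (N : set G) : set (set G) :=
  [set phi @` N | phi in automorphism].

Definition aut_action : set (set G -> set G) :=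
  [set (fun N => phi @` N) | phi in automorphism].

Fixpoint na_eval (n : nat) (h : 'I_n -> G) (m : na_monomial n) : G :=
  match m with
  | NaVar i => h i
  | NaMul m1 m2 => mul (na_eval h m1) (na_eval h m2)
  end.

Definition free_eval (n : nat) (w : free_elt K n) (h : 'I_n -> G) : G :=
  \sum_(p <- w) p.1 *: na_eval h p.2.

Definition word_set (n : nat) (w : free_elt K n) (H : set G) : set G :=
  [set free_eval w h | h in [set h : 'I_n -> G | forall i, H (h i)]].

End Algebra.

Section IdealLattices.
Variables (K : fieldType) (G : lmodType K) (mul : {bilinear G -> G -> G}).

Lemma subspaceD (A : set G) x y : linear_subspace A -> A x -> A y -> A (x + y).
Proof. by case=> _ h Ax Ay; rewrite -[x]scale1r; apply: h. Qed.

Lemma subspaceZ (A : set G) a x : linear_subspace A -> A x -> A (a *: x).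
Proof. by case=> A0 h Ax; rewrite -[_ *: _]addr0; apply: h. Qed.

Lemma subspaceB (A : set G) x y : linear_subspace A -> A x -> A y -> A (x - y).
Proof. by move=> sA Ax Ay; rewrite -scaleN1r; apply: subspaceD => //; apply: subspaceZ. Qed.

Lemma subspace_add (A B : set G) :
  linear_subspace A -> linear_subspace B -> linear_subspace (add_set A B).
Proof.
move=> sA sB; split.
  by exists 0; [case: sA | exists 0; [case: sB | rewrite addr0]].
move=> a _ _ [x Ax [y By <-]] [x' Ax' [y' By' <-]].
exists (a *: x + x'); first by apply: sA.2.
exists (a *: y + y'); first by apply: sB.2.
by rewrite scalerDr addrACA.
Qed.

Lemma add_subl (A B : set G) : linear_subspace B -> A `<=` add_set A B.
Proof. by case=> B0 _ x Ax; exists x => //; exists 0 => //; rewrite addr0. Qed.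

Lemma add_subr (A B : set G) : linear_subspace A -> B `<=` add_set A B.
Proof. by case=> A0 _ x Bx; exists 0 => //; exists x => //; rewrite add0r. Qed.

Lemma add_sub (A B C : set G) :
  linear_subspace C -> A `<=` C -> B `<=` C -> add_set A B `<=` C.
Proof.
by move=> sC hA hB _ [x /hA Cx [y /hB Cy <-]]; apply: subspaceD.
Qed.

Lemma add_setS (A A' B B' : set G) :
  A `<=` A' -> B `<=` B' -> add_set A B `<=` add_set A' B'.
Proof.
by move=> AA BB _ [x Ax [y By <-]]; exists x; [exact: AA | exists y => //; exact: BB].
Qed.

Record ideal_kind (P : set (set G)) : Prop := IdealKind {
  ik_subspace : forall A, P A -> linear_subspace A;
  ik_full : P setT;
  ik_add : forall A B, P A -> P B -> P (add_set A B);
  ik_cap : forall A B, P A -> P B -> P (A `&` B);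
  ik_preim : forall phi A, automorphism mul phi -> P A -> P (phi @^-1` A)
}.

Lemma subspace_setT : linear_subspace [set: G].
Proof. by split. Qed.

Lemma subspace_cap (A B : set G) :
  linear_subspace A -> linear_subspace B -> linear_subspace (A `&` B).
Proof.
move=> [zA sA] [zB sB]; split=> [|a x y [Ax Bx] [Ay By]]; first by [].
by split; [exact: sA | exact: sB].
Qed.

Lemma subspace_preim phi (A : set G) :
  automorphism mul phi -> linear_subspace A -> linear_subspace (phi @^-1` A).
Proof.
move=> [lphi _ _] [A0 sA]; split => [|a x y Ax Ay]; last first.
  by rewrite /preimage /= lphi; apply: sA.
suff e : phi 0 = 0 by rewrite /preimage /= e.
have := lphi (-1) 0 0; rewrite scaler0 addr0 scaleN1r addNr; exact.
Qed.

Lemma left_ideal_kind : ideal_kind (left_ideal mul).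
Proof.
split.
- by move=> A [].
- by split; first exact: subspace_setT.
- move=> A B [sA lA] [sB lB]; split; first exact: subspace_add.
  move=> g _ [x Ax [y By <-]].
  by exists (mul g x); [exact: lA | exists (mul g y); [exact: lB | rewrite linearDr]].
- move=> A B [sA lA] [sB lB]; split; first exact: subspace_cap.
  by move=> g x [? ?]; split; [exact: lA|exact: lB].
- move=> phi A aphi [sA lA]; split; first exact: subspace_preim.
  by case: aphi => _ _ mphi g x Ax; rewrite /preimage /= mphi; apply: lA.
Qed.

Lemma two_sided_ideal_kind : ideal_kind (two_sided_ideal mul).
Proof.
split.
- by move=> A [].
- by split; first exact: subspace_setT.
- move=> A B [sA lA] [sB lB]; split; first exact: subspace_add.
  move=> g _ [x Ax [y By <-]]; have [? ?] := lA g _ Ax; have [? ?] := lB g _ By.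
  split.
    by exists (mul g x) => //; exists (mul g y) => //; rewrite linearDr.
  by exists (mul x g) => //; exists (mul y g) => //; rewrite linearDl.
- move=> A B [sA lA] [sB lB]; split; first exact: subspace_cap.
  move=> g x [/(lA g)[? ?] /(lB g)[? ?]]; by split; split.
- move=> phi A aphi [sA lA]; split; first exact: subspace_preim.
  by case: aphi => _ _ mphi g x Ax; rewrite /preimage /= !mphi; apply: lA.
Qed.

Lemma automorphism_inv phi : automorphism mul phi ->
  exists2 psi, automorphism mul psi & cancel phi psi /\ cancel psi phi.
Proof.
move=> [lphi [psi c1 c2] mphi]; exists psi => //; split.
- by move=> a x y; apply: (can_inj c1); rewrite lphi !c2.
- by exists phi.
- by move=> x y; apply: (can_inj c1); rewrite mphi !c2.
Qed.

Lemma automorphism_comp phi psi :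
  automorphism mul phi -> automorphism mul psi -> automorphism mul (phi \o psi).
Proof.
move=> [lphi bphi mphi] [lpsi bpsi mpsi]; split.
- by move=> a x y; rewrite /= lpsi lphi.
- exact: bij_comp.
- by move=> x y; rewrite /= mpsi mphi.
Qed.

Lemma image_preim (phi psi : G -> G) (A : set G) :
  cancel phi psi -> cancel psi phi -> phi @` A = psi @^-1` A.
Proof.
move=> c1 c2; rewrite eqEsubset; split => [_ [x Ax <-]|x Ax].
  by rewrite /preimage /= c1.
by exists (psi x).
Qed.

Section IdealKind.
Variables (P : set (set G)) (kP : ideal_kind P).

Definition acc_ideals : set (set G) := [set A | P A /\ acc_above P A].

Lemma acc_aboveS A B : A `<=` B -> acc_above P A -> acc_above P B.
Proof.
move=> AB aA C hC; apply: aA => i; have [? hB ?] := hC i.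
by split => //; apply: subset_trans hB.
Qed.

Lemma acc_full : acc_ideals setT.
Proof.
split; first exact: (ik_full kP).
move=> C hC; exists 0%N => i _; have e j : C j = setT.
  by have [_ + _] := hC j; rewrite subTset.
by rewrite !e.
Qed.

Lemma acc_add A B : acc_ideals A -> acc_ideals B -> acc_ideals (add_set A B).
Proof.
move=> [pA aA] [pB _]; split; first exact: (ik_add kP).
by apply: acc_aboveS aA; apply: add_subl; exact: (ik_subspace kP).
Qed.

Lemma acc_cap A B : acc_ideals A -> acc_ideals B -> acc_ideals (A `&` B).
Proof.
move=> [pA aA] [pB aB]; split; first exact: (ik_cap kP).
move=> C hC.
have pC i : P (C i) by have [] := hC i.
have sA := ik_subspace kP pA; have sB := ik_subspace kP pB.
have sC i := ik_subspace kP (pC i).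
have CS i : C i `<=` C i.+1 by have [] := hC i.
have [|m1 h1] := aA (fun i => add_set (C i) A).
  move=> i; split; first exact: (ik_add kP).
    exact: add_subr.
  by apply: add_setS.
have [|m2 h2] := aB (fun i => add_set (C i `&` A) B).
  move=> i; split; first by apply: (ik_add kP) => //; apply: (ik_cap kP).
    by apply: add_subr; apply: subspace_cap.
  by apply: add_setS => //; apply: setSI.
have mono i j : (i <= j)%N -> C i `<=` C j.
  elim: j => [|j IH]; first by rewrite leqn0 => /eqP ->.
  rewrite leq_eqVlt => /orP[/eqP -> //|/IH h]; exact: subset_trans (CS j).
pose m := maxn m1 m2; exists m => i mi; rewrite eqEsubset; split; last exact: mono.
have m1m : (m1 <= m)%N by exact: leq_maxl.
have m2m : (m2 <= m)%N by exact: leq_maxr.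
have capC : C i `&` A `<=` C m.
  move=> x xCA.
  have : add_set (C i `&` A) B x by apply: add_subl.
  rewrite (h2 _ (leq_trans m2m mi)) -(h2 _ m2m) => -[y [yC yA] [z zB e]].
  have [_ ABC _] := hC m.
  rewrite -e; apply: subspaceD => //; apply: ABC; split=> //.
  have -> : z = x - y by rewrite -e addrC addKr.
  by apply: subspaceB => //; case: xCA.
move=> x xC.
have : add_set (C i) A x by apply: add_subl.
rewrite (h1 _ (leq_trans m1m mi)) -(h1 _ m1m) => -[y yC [z zA e]].
rewrite -e; apply: subspaceD => //; apply: capC; split=> //.
have -> : z = x - y by rewrite -e addrC addKr.
by apply: subspaceB => //; exact: mono yC.
Qed.

Lemma acc_preim phi A :
  automorphism mul phi -> acc_ideals A -> acc_ideals (phi @^-1` A).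
Proof.
move=> aphi [pA aA]; split; first exact: (ik_preim kP).
have [psi apsi [c1 c2]] := automorphism_inv aphi.
move=> C hC.
have [|m hm] := aA (fun i => psi @^-1` C i).
  move=> i; have [pC hA CS] := hC i; split; first exact: (ik_preim kP).
    by move=> x Ax; apply: hA; rewrite /preimage /= c2.
  by move=> x; apply: CS.
exists m => i /hm e; rewrite eqEsubset.
split=> x xC.
  by have : (psi @^-1` C m) (phi x); [rewrite -e /preimage /= c1|rewrite /preimage /= c1].
by have : (psi @^-1` C i) (phi x); [rewrite e /preimage /= c1|rewrite /preimage /= c1].
Qed.

Lemma acc_image phi A :
  automorphism mul phi -> acc_ideals A -> acc_ideals (phi @` A).
Proof.
move=> aphi aA; have [psi apsi [c1 c2]] := automorphism_inv aphi.
by rewrite (image_preim A c1 c2); apply: acc_preim.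
Qed.

Lemma acc_sup (X : set (set G)) :
  finite_set X -> X !=set0 -> X `<=` acc_ideals ->
  exists s, lub_in acc_ideals X s.
Proof.
move=> /finite_seqP [s ->] [A0 /= A0s].
suff H (t : seq (set G)) A : acc_ideals A -> (forall B, B \in t -> acc_ideals B) ->
    exists S, lub_in acc_ideals [set` A :: t] S.
  move=> hs; case: s hs A0s => [//|A t] hs _; apply: H.
    by apply: hs; rewrite /= mem_head.
  by move=> B Bt; apply: hs; rewrite /= inE Bt orbT.
elim: t A => [|B t IH] A hA ht.
  exists A; split=> //; first by move=> C /=; rewrite inE => /eqP ->.
  by move=> u _; apply; rewrite /= mem_head.
have hB : acc_ideals B by apply: ht; rewrite mem_head.
have sA := ik_subspace kP hA.1; have sB := ik_subspace kP hB.1.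
have [||S [hS ub lub]] := IH (add_set A B).
- exact: acc_add.
- by move=> C Ct; apply: ht; rewrite inE Ct orbT.
have ABS : add_set A B `<=` S by rewrite -subsetEset; apply: ub; rewrite /= mem_head.
exists S; split=> //.
  move=> C; rewrite /= !in_cons => /or3P[/eqP ->|/eqP ->|Ct].
  - by rewrite subsetEset; apply: subset_trans ABS; apply: add_subl.
  - by rewrite subsetEset; apply: subset_trans ABS; apply: add_subr.
  - by apply: ub; rewrite /= in_cons Ct orbT.
move=> u hu uu; apply: lub => // C /=; rewrite inE => /orP[/eqP ->|Ct]; last first.
  by apply: uu; rewrite /= !inE Ct !orbT.
rewrite subsetEset; apply: add_sub; first exact: (ik_subspace kP hu.1).
  by rewrite -subsetEset; apply: uu; rewrite /= !inE eqxx.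
by rewrite -subsetEset; apply: uu; rewrite /= !inE eqxx orbT.
Qed.

Lemma acc_directed (X : set (set G)) :
  finite_set X -> X `<=` acc_ideals ->
  exists m, acc_ideals m /\ lbound X m.
Proof.
move=> /finite_seqP [s ->]; elim: s => [|A s IH] hs.
  by exists setT; split; first exact: acc_full.
have [|m [hm lm]] := IH; first by move=> B Bs; apply: hs; rewrite /= inE Bs orbT.
exists (A `&` m); split; first by apply: acc_cap => //; apply: hs; rewrite /= mem_head.
move=> B /=; rewrite inE => /orP[/eqP ->|Bs]; rewrite subsetEset => x [Ax mx] //.
by have := lm B Bs; rewrite subsetEset; apply.
Qed.

Lemma acc_noetherian :
  ~ exists C : nat -> set G, forall n, acc_ideals (C n) /\ (C n < C n.+1)%O.
Proof.
move=> [C hC]; have [pC0 aC0] := (hC 0%N).1.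
have CS n : C n `<=` C n.+1 by rewrite -subsetEset; apply: ltW; exact: (hC n).2.
have C0 n : C 0%N `<=` C n by elim: n => // n IH; exact: subset_trans (CS n).
have [|m hm] := aC0 C; first by move=> n; split=> //; exact: (hC n).1.1.
by have := (hC m).2; rewrite (hm m.+1) // ltxx.
Qed.

Definition acc_semilattice : ndSemilattice (set G) :=
  NdSemilattice acc_sup acc_directed acc_noetherian.

Lemma aut_action_endo f : aut_action mul f -> semilattice_endo acc_ideals f.
Proof.
move=> [phi aphi <-]; have [psi apsi [c1 c2]] := automorphism_inv aphi.
split=> [A hA|X s _ _ _ [hs ub lub]]; first exact: acc_image.
split; first exact: acc_image.
- by move=> _ [A XA <-]; rewrite subsetEset; apply: image_subset; rewrite -subsetEset; exact: ub.
- move=> u hu uu; rewrite (image_preim s c1 c2) subsetEset.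
  have : (s <= phi @^-1` u)%O.
    apply: lub; first exact: acc_preim.
    move=> A XA; rewrite subsetEset => x Ax.
    have : (phi @` A <= u)%O by apply: uu; exists A.
    by rewrite subsetEset; apply; exists x.
  by rewrite subsetEset => h x /h; rewrite /preimage /= c2.
Qed.

Lemma aut_action_comp f g :
  aut_action mul f -> aut_action mul g -> aut_action mul (f \o g).
Proof.
move=> [phi aphi <-] [psi apsi <-]; exists (phi \o psi).
  exact: automorphism_comp.
by apply/funext => A /=; rewrite image_comp.
Qed.

Definition aut_semigroup : endoSemigroup acc_semilattice :=
  @EndoSemigroup _ _ acc_semilattice _ aut_action_endo aut_action_comp.

End IdealKind.

Definition left_lattice : ndSemilattice (set G) :=
  acc_semilattice left_ideal_kind.

Definition two_sided_lattice : ndSemilattice (set G) :=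
  acc_semilattice two_sided_ideal_kind.

Definition left_aut : endoSemigroup left_lattice :=
  aut_semigroup left_ideal_kind.

Definition two_sided_aut : endoSemigroup two_sided_lattice :=
  aut_semigroup two_sided_ideal_kind.

End IdealLattices.

(* Main.v *)
Require Import Defs.
From HB Require Import structures.
From mathcomp Require Import all_boot all_order all_algebra.
From mathcomp Require Import all_classical all_reals ereal.
Import Order.TTheory GRing.Theory Num.Theory.
Local Open Scope classical_set_scope.
Local Open Scope ring_scope.
Set Implicit Arguments.
Unset Strict Implicit.
Unset Printing Implicit Defensive.

(** Call a subspace large if it belongs to the class at hand: finite
codimension, or (left or two-sided) ideal with Noetherian factor.  For a large
[A] finitely many images [phi_1 A, ..., phi_r A] have the same sum as all the
images of [A]; this sum [orbit_sum A] is therefore characteristic, and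
[core A = phi_1 A :&: ... :&: phi_r A] is again large.  Put
[A_0 = N], [A_(k+1) = core A_k] and [S_k = orbit_sum A_k].  The theorem holds
with [H_t = S_(t-1)].

Codimension: if [r] is chosen minimal then [r <= codim A + 1] for every
admissible codimension at once, so [codim (core A) <= r * codim A <=
f (codim A)] ([codim_core]), while [orbit_sum A] contains [A] and so has no
larger codimension.

Words: the [S_k] decrease, so for [n <= t] the arguments of [w] taken in [H_t]
lie in [S_0, ..., S_(n-1)], one argument in each.  Use up these sums from the
last to the first.  Assume that the arguments with index below [k] lie in their
sums, the one with index [k] lies in [S_k], and the later ones in [A_(k+1)].
Decompose the argument with index [k] as a sum of elements of [phi_i A_k]; by
multilinearity the value of [w] splits accordingly.  In the [i]-th summand the
later arguments also lie in [phi_i A_k], because [A_(k+1)] is the intersection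
of these images, and the earlier ones lie in characteristic subspaces; so
[phi_i] can be pulled out, leaving a value of [w] with all arguments of index at
least [k] in [A_k] ([word_values_step]).  After [n] steps every argument is in
[N].

Finite families with the full sum come from the chain condition
([acc_spanning]), from the supremum axiom of a generalized codimension
([gen_codim_class]), or from the drop of the dimension
([finite_codim_spanning]).  For ordinary codimension, subspaces of finite
codimension are handled as kernels of linear maps into row spaces. *)

Lemma min_nat_exists (P : nat -> Prop) :
  (exists n, P n) -> exists n, P n /\ forall k, P k -> (n <= k)%N.
Proof.
move=> [n Pn]; have ex : exists n, `[< P n >] by exists n; apply/asboolP.
case: (ex_minnP ex) => m /asboolP Pm min; exists m; split=> // k Pk.
by apply: min; apply/asboolP.
Qed.

(** * Finite sums and intersections of automorphic images *)

Section Orbits.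
Variables (K : fieldType) (G : lmodType K) (mul : {bilinear G -> G -> G}).
Implicit Types (A B X Y : set G) (phi psi : G -> G) (s : seq (G -> G)).
Local Notation aut := (automorphism mul).

Lemma automorphism_id : aut id.
Proof. by split=> //; exists id. Qed.

Lemma automorphismD phi x y : aut phi -> phi (x + y) = phi x + phi y.
Proof. by case=> lphi _ _; rewrite -[x in LHS]scale1r lphi scale1r. Qed.

Lemma automorphism0 phi : aut phi -> phi 0 = 0.
Proof. by move=> aphi; apply: (addrI (phi 0)); rewrite -automorphismD // !addr0. Qed.

Lemma automorphismZ phi a x : aut phi -> phi (a *: x) = a *: phi x.
Proof.
by move=> aphi; case: (aphi) => lphi _ _; rewrite -[a *: x]addr0 lphi automorphism0 // addr0.
Qed.

Lemma subspace_image phi A : aut phi -> linear_subspace A -> linear_subspace (phi @` A).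
Proof.
move=> aphi sA; have [psi apsi [c1 c2]] := automorphism_inv aphi.
by rewrite (image_preim A c1 c2); apply: subspace_preim apsi sA.
Qed.

(** A recursive conjunction, so that it unfolds along with [imsum] and [imcap]. *)
Definition auts s : Prop := foldr (fun phi Q => aut phi /\ Q) True s.

Lemma auts_in s phi : auts s -> phi \in s -> aut phi.
Proof.
elim: s => [//|psi s IH] [apsi hs]; rewrite inE => /predU1P[-> //|]; exact: IH.
Qed.

Lemma auts_cat s1 s2 : auts s1 -> auts s2 -> auts (s1 ++ s2).
Proof. by elim: s1 => [//|phi s1 IH] [? h] ?; split=> //; apply: IH. Qed.

Lemma auts_map phi s : aut phi -> auts s -> auts [seq phi \o psi | psi <- s].
Proof.
by move=> aphi; elim: s => [//|psi s IH] [? h]; split; [exact: automorphism_comp|exact: IH].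
Qed.

(** Defined for arbitrary subsets [X], since it is applied both to subspaces and
to the value sets of words, which are not closed under addition. *)
Definition imsum s X : set G := foldr (fun phi S => add_set (phi @` X) S) [set 0] s.

Definition imcap s X : set G := foldr (fun phi S => phi @` X `&` S) setT s.

Lemma imsum_cat s1 s2 X x y :
  imsum s1 X x -> imsum s2 X y -> imsum (s1 ++ s2) X (x + y).
Proof.
move=> + hy; elim: s1 x => [|phi s1 IH] x /=; first by move=> ->; rewrite add0r.
move=> [u hu [v hv <-]]; exists u => //; exists (v + y); first exact: IH.
by rewrite addrA.
Qed.

Lemma imsum_comp phi s X x : aut phi ->
  imsum s X x -> imsum [seq phi \o psi | psi <- s] X (phi x).
Proof.
move=> aphi; elim: s x => [|psi s IH] x /=; first by move=> ->; exact: automorphism0.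
move=> [_ [u hu <-] [v hv <-]]; rewrite automorphismD //.
by exists (phi (psi u)); [exists u | exists (phi v) => //; exact: IH].
Qed.

Lemma imsum_subspace s A : auts s -> linear_subspace A -> linear_subspace (imsum s A).
Proof.
move=> + sA; elim: s => [_|phi s IH [aphi /IH h]] /=.
  by split=> // a _ _ -> ->; rewrite /= scaler0 addr0.
by apply: subspace_add => //; exact: subspace_image.
Qed.

Definition covered X Y : Prop := exists2 s, auts s & Y `<=` imsum s X.

Lemma covered_trans X Y Z : covered X Y -> covered Y Z -> covered X Z.
Proof.
move=> [s hs YX] [t ht ZY].
suff [u hu tu] : covered X (imsum t Y) by exists u => // z /ZY /tu.
elim: t ht {ZY} => [_|phi t IH [aphi /IH [u hu tu]]]; first by exists [::].
exists ([seq phi \o psi | psi <- s] ++ u); first by apply: auts_cat => //; exact: auts_map.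
move=> _ [_ [y Yy <-] [v /tu hv <-]]; apply: imsum_cat => //.
by apply: imsum_comp => //; exact: YX.
Qed.

(** Translates a list of automorphisms into the indexed form of the statement. *)
Lemma covered_sum_sets X Y : covered X Y ->
  exists (k : nat) (phi : 'I_k -> G -> G),
    (forall i, aut (phi i)) /\ Y `<=` sum_sets (fun i => phi i @` X).
Proof.
move=> [s hs YX]; exists (size s), (fun i => nth id s i); split.
  elim: s hs {YX} => [_ []//|phi s IH [aphi /IH h] i].
  case: (unliftP ord0 i) => [j ->|->] //=; exact: h.
move=> y /YX; elim: s y {YX hs} => [|phi s IH] y /=.
  by move=> ->; exists (fun=> 0); [case | rewrite big_ord0].
move=> [u hu [v /IH [x hx <-] <-]].
exists (fun i => oapp x u (unlift ord0 i)).
  by move=> i; case: unliftP => [j ->|->] //=; exact: hx.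
by rewrite big_ord_recl unlift_none; congr (_ + _); apply: eq_bigr => i _; rewrite liftK.
Qed.

(** * Orbit sum and core of a subspace *)

(** Nonemptiness matters twice: the empty sum and the empty intersection need not
belong to the lattice generated by the images of [A]. *)
Definition spanning A s : Prop :=
  [/\ auts s, (0 < size s)%N & forall psi, aut psi -> psi @` A `<=` imsum s A].

Definition min_spanning A s : Prop :=
  spanning A s /\ forall s', spanning A s' -> (size s <= size s')%N.

(** A spanning list of least length: this single choice is as good as the one
provided by any particular codimension function, so that the subspaces [H_t] do
not depend on which codimension is estimated. *)
Definition family A : seq (G -> G) := xget ([:: id] : seq (G -> G)) [set s | min_spanning A s].

Lemma familyP A : (exists s, spanning A s) -> min_spanning A (family A).
Proof.
move=> [s hs]; rewrite /family.
have [|n [[u [hu un]] min]] := @min_nat_exists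
  (fun n => exists s, spanning A s /\ size s = n); first by exists (size s), s.
suff hmin : min_spanning A u.
  by case: xgetP => [v _ hv|/(_ u hmin)].
by split=> // s' hs'; rewrite un; apply: min; exists s'.
Qed.

Definition orbit_sum A : set G := imsum (family A) A.

Definition core A : set G := imcap (family A) A.

Lemma spanning_subset A s B :
  linear_subspace B -> auts s -> (forall psi, aut psi -> psi @` A `<=` B) -> imsum s A `<=` B.
Proof.
move=> sB + AB; elim: s => [_ _ ->|phi s IH [aphi /IH h]] /=; first by case: sB.
by apply: add_sub => //; exact: AB.
Qed.

(** The sum of all images of [A] is permuted into itself by automorphisms; one
inclusion is enough because automorphisms are invertible. *)
Lemma spanning_characteristic A s :
  linear_subspace A -> spanning A s -> characteristic mul (imsum s A).
Proof.
move=> sA [hs _ sp] phi aphi.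
have sub psi : aut psi -> imsum s A `<=` psi @^-1` imsum s A.
  move=> apsi; apply: spanning_subset => //.
    by apply: subspace_preim apsi _; exact: imsum_subspace.
  move=> rho arho _ [x Ax <-]; rewrite /preimage /=.
  by apply: (sp _ (automorphism_comp apsi arho)); exists x.
have [psi apsi [c1 c2]] := automorphism_inv aphi.
rewrite eqEsubset; split=> [_ [x hx <-]|x hx]; first exact: sub.
by exists (psi x) => //; exact: sub.
Qed.

Lemma add_set0 A : add_set A [set 0] = A.
Proof.
rewrite eqEsubset; split=> [_ [x hx [_ -> <-]]|x hx]; first by rewrite addr0.
by exists x => //; exists 0 => //; rewrite addr0.
Qed.

Lemma imsum_in_lattice S A s : sublattice S -> (forall phi, aut phi -> S (phi @` A)) ->
  auts s -> (0 < size s)%N -> S (imsum s A).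
Proof.
move=> latS SA; case: s => [//|phi s] [aphi hs] _ /=.
elim: s phi aphi hs => [|psi s IH] phi aphi /=.
  by move=> _; rewrite add_set0; exact: SA.
by move=> [apsi hs]; apply: (latS _ _ _ _).1; [exact: SA|exact: IH].
Qed.

Lemma imcap_in_lattice S A s : (forall B C, S B -> S C -> S (B `&` C)) ->
  (forall phi, aut phi -> S (phi @` A)) -> auts s -> (0 < size s)%N -> S (imcap s A).
Proof.
move=> capS SA; case: s => [//|phi s] [aphi hs] _ /=.
elim: s phi aphi hs => [|psi s IH] phi aphi /=; first by move=> _; rewrite setIT; exact: SA.
by move=> [apsi hs]; apply: capS; [exact: SA|exact: IH].
Qed.

Section Large.
Variable C : set (set G).

(** The properties shared by the three kinds of large subspaces. *)
Record large_class : Prop := LargeClass {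
  large_subspace : forall A, C A -> linear_subspace A;
  large_image : forall phi A, aut phi -> C A -> C (phi @` A);
  large_cap : forall A B, C A -> C B -> C (A `&` B);
  large_add : forall A B, C A -> C B -> C (add_set A B);
  large_spanning : forall A, C A -> exists s, spanning A s
}.

(** The properties shared by the ordinary and the generalized codimensions. *)
Record class_codim (R : realType) (codim : set G -> R) : Prop := ClassCodim {
  codim_antitone : forall A B, C A -> C B -> A `<=` B -> codim B <= codim A;
  codim_image : forall phi A, aut phi -> C A -> codim (phi @` A) <= codim A;
  codim_cap : forall A B, C A -> C B -> codim (A `&` B) <= codim A + codim B;
  codim_spanning : forall A, C A ->
    exists2 s, spanning A s & (size s)%:R <= codim A + 1
}.

Hypothesis large : large_class.

Lemma large_family A : C A -> spanning A (family A).
Proof. by move=> /(large_spanning large)/familyP[]. Qed.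

Lemma large_core A : C A -> C (core A).
Proof.
move=> CA; have [hs hn _] := large_family CA.
apply: imcap_in_lattice hn => //; first exact: large_cap.
by move=> phi aphi; exact: large_image.
Qed.

Lemma large_stage N k : C N -> C (iter k core N).
Proof. by move=> CN; elim: k => [//|k IH]; exact: large_core. Qed.

Lemma large_imsum A s : C A -> auts s -> (0 < size s)%N -> C (imsum s A).
Proof.
move=> CA hs hn; apply: imsum_in_lattice hs hn; last by move=> *; exact: large_image.
by move=> B D CB CD; split; [exact: large_add|exact: large_cap].
Qed.

Lemma large_orbit_sum A : C A -> C (orbit_sum A).
Proof. by move=> CA; have [hs hn _] := large_family CA; exact: large_imsum. Qed.

Lemma orbit_sum_characteristic A : C A -> characteristic mul (orbit_sum A).
Proof.
move=> CA; apply: spanning_characteristic (large_family CA).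
exact: (large_subspace large).
Qed.

Lemma sub_orbit_sum A phi : C A -> aut phi -> phi @` A `<=` orbit_sum A.
Proof. by move=> CA; have [_ _] := large_family CA; apply. Qed.

Lemma core_sub A phi : phi \in family A -> core A `<=` phi @` A.
Proof.
rewrite /core; elim: (family A) => [//|psi s IH].
rewrite inE => /predU1P[->|/IH h] /=; first exact: subIsetl.
by apply: subset_trans h; exact: subIsetr.
Qed.

(** The core is contained in some image of [A], hence all images of the core are
contained in the characteristic subspace [orbit_sum A]. *)
Lemma core_orbit_sum A : C A -> orbit_sum (core A) `<=` orbit_sum A.
Proof.
move=> CA; have [hs hn _] := large_family CA.
have [phi hphi] : exists phi, phi \in family A.
  by case: (family A) hn => [//|phi s] _; exists phi; exact: mem_head.
have aphi : aut phi.
  exact: auts_in hphi.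
have [hs' hn' _] := large_family (large_core CA).
apply: spanning_subset hs' _.
  exact: (large_subspace large (large_orbit_sum CA)).
move=> psi apsi.
rewrite -(orbit_sum_characteristic CA apsi); apply: image_subset.
by apply: subset_trans (core_sub hphi) _; exact: sub_orbit_sum.
Qed.

Lemma orbit_sum_stage_mono N i j : C N -> (i <= j)%N ->
  orbit_sum (iter j core N) `<=` orbit_sum (iter i core N).
Proof.
move=> CN; elim: j => [|j IH]; first by rewrite leqn0 => /eqP ->.
rewrite leq_eqVlt => /orP[/eqP -> //|/IH h]; apply: subset_trans h.
by apply: core_orbit_sum; exact: large_stage.
Qed.

(** An automorphism carries the core to the intersection of the images of [A]
under the composite automorphisms; hence the induction must be about all the
images of a stage rather than about the stage alone. *)
Lemma stage_in_lattice N S k : C N -> sublattice S -> aut_images mul N `<=` S ->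
  forall phi, aut phi -> S (phi @` iter k core N).
Proof.
move=> CN latS NS; elim: k => [|k IH] phi aphi; first by apply: NS; exists phi.
have [hs hn _] := large_family (large_stage k CN).
have [psi apsi [c1 c2]] := automorphism_inv aphi.
have capS B D : S B -> S D -> S (B `&` D) by move=> SB SD; have [] := latS _ _ SB SD.
rewrite iterS (image_preim _ c1 c2).
have -> : psi @^-1` core (iter k core N) =
    imcap [seq phi \o f | f <- family (iter k core N)] (iter k core N).
  rewrite /core; elim: (family _) => [//|f s IHs] /=.
  by rewrite -IHs preimage_setI -image_comp (image_preim (f @` _) c1 c2).
apply: imcap_in_lattice => //; last by rewrite size_map.
exact: auts_map.
Qed.

(** * Growth of the codimension *)

Section Codim.
Variables (R : realType) (codim : set G -> R).
Hypothesis hcodim : class_codim codim.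
Local Notation f := (fun x : R => x * (x + 1)).

(** Apply subadditivity to [A :&: A]. *)
Lemma codim_ge0 A : C A -> 0 <= codim A.
Proof.
by move=> CA; have := codim_cap hcodim CA CA; rewrite setIid lerDl.
Qed.

Lemma codim_orbit_sum A : C A -> codim (orbit_sum A) <= codim A.
Proof.
move=> CA; apply: (codim_antitone hcodim) => //; first exact: large_orbit_sum.
by rewrite -[A in A `<=` _]image_id; apply: sub_orbit_sum => //; exact: automorphism_id.
Qed.

(** The intersection of [r] images has codimension at most [r * codim A], and
[r <= codim A + 1] since [r] is minimal among the lengths of spanning lists. *)
Lemma codim_core A : C A -> codim (core A) <= f (codim A).
Proof.
move=> CA; have [s sp hs] := codim_spanning hcodim CA.
have [[ha hn _] min] := familyP (large_spanning large CA).
have le : codim (core A) <= codim A *+ size (family A).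
  rewrite /core; case: (family A) ha hn {min} => [//|phi u] [aphi hu] _ /=.
  elim: u phi aphi hu => [|psi u IH] phi aphi /=.
    by move=> _; rewrite setIT; exact: (codim_image hcodim).
  move=> [apsi hu]; rewrite mulrS.
  apply: le_trans (codim_cap hcodim _ _) _; first exact: (large_image large).
    apply: (@imcap_in_lattice C A (psi :: u)) => //; first exact: (large_cap large).
    by move=> *; exact: (large_image large).
  by apply: lerD; [exact: (codim_image hcodim)|exact: IH].
apply: le_trans le _; rewrite -mulr_natr; apply: ler_wpM2l; first exact: codim_ge0.
by apply: le_trans hs; rewrite ler_nat; exact: min.
Qed.

Lemma iter_bound_mono k (x y : R) : 0 <= x -> x <= y -> 0 <= iter k f x <= iter k f y.
Proof.
move=> x0 xy; elim: k => [|k /andP[h0 h]]; first by rewrite /= x0.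
rewrite !iterS mulr_ge0 ?addr_ge0 //=.
by apply: ler_pM => //; rewrite ?addr_ge0 // lerD2r.
Qed.

Lemma codim_stage N k : C N -> codim (iter k core N) <= iter k f (codim N).
Proof.
move=> CN; elim: k => [//|k IH]; have Ck := large_stage k CN.
rewrite !iterS; apply: le_trans (codim_core Ck) _.
by have /andP[_] := iter_bound_mono 1 (codim_ge0 Ck) IH.
Qed.

Lemma codim_orbit_sum_stage N k : C N ->
  codim (orbit_sum (iter k core N)) <= iter k f (codim N).
Proof.
move=> CN; apply: le_trans (codim_stage k CN).
by apply: codim_orbit_sum; exact: large_stage.
Qed.

End Codim.
End Large.

(** * Values of multilinear elements *)

Section Words.
Variable n : nat.
Implicit Types (h : 'I_n -> G) (m : na_monomial n) (w : free_elt K n).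

Definition update h k x : 'I_n -> G := fun i => if i == k then x else h i.

Lemma na_eval_aut phi h m : aut phi -> na_eval mul (phi \o h) m = phi (na_eval mul h m).
Proof.
by case=> _ _ mphi; elim: m => [//|m1 IH1 m2 IH2] /=; rewrite IH1 IH2 mphi.
Qed.

Lemma free_eval_aut phi h w : aut phi -> free_eval mul w (phi \o h) = phi (free_eval mul w h).
Proof.
move=> aphi; rewrite /free_eval; elim: w => [|p w IH].
  by rewrite !big_nil automorphism0.
by rewrite !big_cons IH na_eval_aut // automorphismD // automorphismZ.
Qed.

Lemma na_eval_update0 h k m x y : count_mem k (na_vars m) = 0%N ->
  na_eval mul (update h k x) m = na_eval mul (update h k y) m.
Proof.
elim: m => [i|m1 IH1 m2 IH2] /=.
  by rewrite /update addn0; case: (i == k).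
by rewrite count_cat => /eqP; rewrite addn_eq0 => /andP[/eqP/IH1 -> /eqP/IH2 ->].
Qed.

(** A variable occurring once is in exactly one factor of each product, so only
that factor varies and bilinearity applies. *)
Lemma na_eval_updateD h k m x y : count_mem k (na_vars m) = 1%N ->
  na_eval mul (update h k (x + y)) m =
  na_eval mul (update h k x) m + na_eval mul (update h k y) m.
Proof.
elim: m => [i|m1 IH1 m2 IH2] /=.
  by rewrite /update addn0; case: (i == k).
rewrite count_cat; case e1: (count_mem k (na_vars m1)) => [|[|//]].
  by rewrite add0n => /IH2 ->; rewrite linearDr !(na_eval_update0 _ _ 0 e1).
rewrite add1n => -[e2]; rewrite (IH1 e1) linearDl.
by rewrite !(na_eval_update0 _ _ 0 e2).
Qed.

Lemma free_eval_updateD h k w x y : multilinear w ->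
  free_eval mul w (update h k (x + y)) =
  free_eval mul w (update h k x) + free_eval mul w (update h k y).
Proof.
rewrite /free_eval; elim: w => [|p w IH] /=; first by rewrite !big_nil addr0.
move=> /andP[/forallP/(_ k)/eqP ck /IH hw].
by rewrite !big_cons hw na_eval_updateD // scalerDr addrACA.
Qed.

Definition word_values w (X : 'I_n -> set G) : set G :=
  [set free_eval mul w h | h in [set h | forall i, X i (h i)]].

Lemma imsum_additive (F : G -> G) s X Y : (forall x y, F (x + y) = F x + F y) ->
  (forall phi, phi \in s -> F @` (phi @` X) `<=` phi @` Y) ->
  F @` imsum s X `<=` imsum s Y.
Proof.
move=> FD; have F0 : F 0 = 0 by apply: (addrI (F 0)); rewrite -FD !addr0.
elim: s => [|phi s IH] hF _ [x hx <-]; first by rewrite hx F0.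
case: hx => u hu [v hv <-]; rewrite FD; exists (F u).
  by apply: hF; [exact: mem_head | exists u].
exists (F v) => //; apply: IH; last by exists v.
by move=> psi hpsi; apply: hF; rewrite inE hpsi orbT.
Qed.

Variables (C : set (set G)) (large : large_class C) (N : set G) (CN : C N).

(** The set allowed for argument [i] once the sums of index at least [k] have been
used up. *)
Definition stage_sets k (i : 'I_n) : set G :=
  if (i < k)%N then orbit_sum (iter i core N) else iter k core N.

(** Decompose the argument with index [k] along the images [phi A_k] whose sum it
belongs to, and pull [phi] out of each summand: the arguments with larger index
are in the core of [A_k], hence in [phi A_k], and those with smaller index are
in subspaces invariant under [phi]. *)
Lemma word_values_step w (k : 'I_n) : multilinear w ->
  word_values w (stage_sets k.+1) `<=`
  imsum (family (iter k core N)) (word_values w (stage_sets k)).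
Proof.
move=> wlin _ [h hh <-].
have Ck := large_stage large k CN.
have [hs _ _] := large_family large Ck.
have -> : free_eval mul w h = free_eval mul w (update h k (h k)).
  by congr free_eval; apply/funext => i; rewrite /update; case: eqP => [->|].
apply: (@imsum_additive (fun x => free_eval mul w (update h k x)) _ (iter k core N)).
- by move=> x y; exact: free_eval_updateD.
- move=> phi hphi _ [_ [y hy <-] <-]; have aphi := auts_in hs hphi.
  have [psi apsi [c1 c2]] := automorphism_inv aphi.
  exists (free_eval mul w (psi \o update h k (phi y))); last first.
    by rewrite (free_eval_aut _ _ apsi) c2.
  exists (psi \o update h k (phi y)) => // i.
  rewrite /update /stage_sets /=; case: eqP => [->|/eqP ik].
    by rewrite ltnn c1.
  have := hh i; rewrite /stage_sets ltnS leq_eqVlt (negbTE ik : (i == k :> nat) = false) /=.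
  case: ltnP => _ hi.
    rewrite -(orbit_sum_characteristic large (large_stage large i CN) apsi).
    by exists (h i).
  by have [z hz <-] := core_sub hphi hi; rewrite c1.
- exists (h k) => //; have := hh k.
  by rewrite /stage_sets ltnSn.
Qed.

Lemma word_covered w t : multilinear w -> (n <= t)%N ->
  covered (word_set mul w N) (word_set mul w (orbit_sum (iter t.-1 core N))).
Proof.
move=> wlin nt.
have cov k : (k <= n)%N -> covered (word_set mul w N) (word_values w (stage_sets k)).
  elim: k => [_|k IH kn].
    exists [:: id]; first by split; first exact: automorphism_id.
    by rewrite /= add_set0 image_id => x [h hh <-]; exists h.
  apply: covered_trans (IH (ltnW kn)) _.
  exists (family (iter k core N)); last exact: (@word_values_step w (Ordinal kn)).
  by have [] := large_family large (large_stage large k CN).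
have [s hs sub] := cov n (leqnn n); exists s => // x [h hh <-].
apply: sub; exists h => // i; rewrite /stage_sets ltn_ord.
apply: (orbit_sum_stage_mono large CN _ (hh i)).
by have := leq_trans (ltn_ord i) nt; case: (t).
Qed.

End Words.

(** * Ideals with Noetherian factors *)

Section Acc.
Variables (P : set (set G)) (kP : ideal_kind mul P).

Lemma acc_imsum A s : acc_ideals P A -> auts s -> (0 < size s)%N -> acc_ideals P (imsum s A).
Proof.
move=> accA; apply: imsum_in_lattice; last by move=> phi aphi; exact: (acc_image kP).
by move=> B D aB aD; split; [exact: (acc_add kP)|exact: (acc_cap kP)].
Qed.

(** If no finite list spans, then every list can be extended by an image not
contained in its sum; this builds a strictly increasing chain of ideals
containing [A]. *)
Lemma acc_spanning A : acc_ideals P A -> exists s, spanning A s.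
Proof.
move=> accA; apply: contrapT => no.
have /choice[next nextP] s : exists psi, auts s -> (0 < size s)%N ->
    aut psi /\ ~ psi @` A `<=` imsum s A.
  apply: contrapT => hpsi; apply: no; exists s.
  split; first by apply: contrapT => h; apply: hpsi; exists id.
    by apply: contrapT => h; apply: hpsi; exists id.
  move=> psi apsi; apply: contrapT => h; apply: hpsi; exists psi.
  by split.
pose u k := iter k (fun s => next s :: s) [:: id].
have ugood k : auts (u k) /\ (0 < size (u k))%N.
  elim: k => [|k [h1 h2]]; first by split=> //; split=> //; exact: automorphism_id.
  by split=> //=; split=> //; have [] := nextP _ h1 h2.
have sA : linear_subspace A by apply: (ik_subspace kP); case: accA.
have mono k : imsum (u k) A `<=` imsum (u k.+1) A.
  apply: add_subr; apply: subspace_image sA.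
  by have [h1 h2] := ugood k; have [] := nextP _ h1 h2.
have [|m hm] := accA.2 (fun k => imsum (u k) A).
  move=> k; split=> //.
    by have [h1 h2] := ugood k; have [] := acc_imsum accA h1 h2.
  elim: k => [|k IH]; last exact: subset_trans (mono k).
  by rewrite /= add_set0 image_id.
have [h1 h2] := ugood m; have [apsi] := nextP _ h1 h2; apply.
rewrite -(hm m.+1) //; apply: add_subl; exact: imsum_subspace.
Qed.

Lemma acc_large_class : large_class (acc_ideals P).
Proof.
split.
- by move=> A [PA _]; exact: (ik_subspace kP).
- by move=> phi A aphi; exact: (acc_image kP).
- by move=> A B; exact: (acc_cap kP).
- by move=> A B; exact: (acc_add kP).
- exact: acc_spanning.
Qed.

(** The supremum of a finite family in the semilattice lies below the sum of the
family, which is itself an element.  So the finite subfamily of images given by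
the supremum axiom has a sum containing all images. *)
Lemma gen_codim_class (R : realType) (codim : set G -> R) :
  gen_codim (aut_semigroup kP) codim -> class_codim (acc_ideals P) codim.
Proof.
case=> anti endo cap sup.
have cap' A B : acc_ideals P A -> acc_ideals P B -> codim (A `&` B) <= codim A + codim B.
  move=> hA hB; have [m [hm mA mB le]] := cap A B hA hB.
  apply: le_trans le; apply: anti => //; first exact: (acc_cap kP).
  rewrite subsetEset => x xm; split.
    by move: x xm; rewrite -/(m `<=` A) -subsetEset.
  by move: x xm; rewrite -/(m `<=` B) -subsetEset.
have endo' phi A : aut phi -> acc_ideals P A -> codim (phi @` A) <= codim A.
  by move=> aphi hA; apply: (endo (fun N => phi @` N)) => //; exists phi.
split=> //.
  by move=> A B hA hB AB; apply: anti => //; rewrite subsetEset.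
move=> A hA.
have c0 : 0 <= codim A by have := cap' A A hA hA; rewrite setIid lerDl.
have AF : aut_images mul A A by exists id; [exact: automorphism_id|exact: image_id].
have [||r [M [FM rle [s [[Ls ubs _] [_ _ lubs]]]]]] := sup (aut_images mul A).
- by move=> _ [phi aphi <-]; exact: (acc_image kP).
- by exists A.
have rle' : r%:R <= codim A + 1.
  rewrite -lee_fin EFinD; apply: le_trans rle _; apply: leeD => //.
  apply: ge_ereal_sup => _ [_ [phi aphi <-] <-].
  by rewrite lee_fin; exact: endo'.
have sub psi B : aut psi -> (s <= B)%O -> psi @` A `<=` B.
  move=> apsi sB; rewrite -subsetEset; apply: le_trans sB.
  by apply: ubs; exists psi.
(* If the subfamily is empty, the supremum of all images is the least element;
   then all images coincide with A and the identity alone spans. *)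
case: r M FM rle rle' lubs => [|r] M FM _ rle lubs.
  exists [:: id]; last by rewrite lerDr.
  split=> //; first by split=> //; exact: automorphism_id.
  move=> psi apsi; rewrite /= add_set0 image_id; apply: sub => //.
  by apply: lubs => // y [[i hi]].
have /choice[phi phiP] i : exists phi, aut phi /\ phi @` A = M i.
  by have [phi ? ?] := FM i; exists phi.
have hs : auts (codom phi).
  rewrite /codom /image_mem; elim: (enum _) => [//|i t IH] /=.
  by split=> //; have [] := phiP i.
exists (codom phi); last by rewrite size_codom card_ord.
have hn : (0 < size (codom phi))%N by rewrite size_codom card_ord.
split=> // psi apsi; apply: sub => //; apply: lubs; first exact: acc_imsum.
move=> _ [i _ <-]; rewrite subsetEset -(phiP i).2.
have : i \in enum 'I_r.+1 by rewrite mem_enum.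
move: hs; rewrite /codom /image_mem => hs; elim: (enum _) hs => [//|j t IH] /= [_ ht].
have sA : linear_subspace A by apply: (ik_subspace kP); case: hA.
have sub' : aut (phi j) by have [] := phiP j.
rewrite inE => /predU1P[->|/IH h].
  by apply: add_subl; exact: imsum_subspace.
by apply: subset_trans (h _) _ => //; apply: add_subr; exact: subspace_image.
Qed.

End Acc.
End Orbits.

(** * Ordinary codimension *)

Section FiniteCodim.
Variables (K : fieldType) (G : lmodType K) (mul : {bilinear G -> G -> G}).
Implicit Types (A B : set G).
Local Notation aut := (automorphism mul).

(** The codimension of [A] is at most [m].  Unlike bases modulo [A], linear maps
restrict and combine directly, which gives intersections and images. *)
Definition kernel_in (m : nat) A : Prop :=
  exists f : {linear G -> 'rV[K]_m}, A = [set g | f g = 0].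

Lemma linear_pack (U V : lmodType K) (f : U -> V) :
  linear f -> exists g : {linear U -> V}, g =1 f.
Proof.
move=> lf; pose l := GRing.isLinear.Build K U V *:%R f lf.
by exists (HB.pack f l : {linear U -> V}).
Qed.

Lemma kernel_in_subspace m A : kernel_in m A -> linear_subspace A.
Proof.
move=> [f ->]; split; first exact: linear0.
by move=> a x y /= fx fy; rewrite linearP fx fy scaler0 addr0.
Qed.

Lemma kernel_in_image m phi A : aut phi -> kernel_in m A -> kernel_in m (phi @` A).
Proof.
move=> aphi [f ->]; have [psi [lpsi _ _] [c1 c2]] := automorphism_inv aphi.
have [g gE] := linear_pack lpsi; exists (f \o g).
rewrite (image_preim _ c1 c2); apply/seteqP.
by split=> x /=; rewrite /preimage /= gE.
Qed.

Lemma kernel_in_cap m n A B : kernel_in m A -> kernel_in n B -> kernel_in (m + n) (A `&` B).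
Proof.
move=> [f ->] [g ->].
have [|h hE] := @linear_pack G _ (fun x => row_mx (f x) (g x)).
  by move=> a x y; rewrite !linearP scale_row_mx add_row_mx.
exists h; apply/seteqP; split=> x /=; rewrite hE.
  by move=> [-> ->]; rewrite row_mx0.
by rewrite -row_mx0 => /eq_row_mx.
Qed.

(** Compose the map with the quotient of the row space by the line through the
nonzero vector [f b]; a basis of the columns of [cokermx] realizes this quotient
in dimension [m - 1]. *)
Lemma kernel_in_line m A b : kernel_in m A -> ~ A b ->
  (0 < m)%N /\ kernel_in m.-1 [set g | exists a, A (g - a *: b)].
Proof.
move=> [f ->] /= /eqP fb.
have m0 : (0 < m)%N.
  by case: m f fb => // f; rewrite [f b]thinmx0 eqxx.
split=> //; pose Q := cokermx (f b).
have <- : \rank Q = m.-1 by rewrite mxrank_coker rank_rV fb subn1.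
exists (mulmxr (col_base Q) \o f : {linear G -> 'rV[K]_(\rank Q)}).
apply/seteqP; split=> x /=.
  move=> [a /eqP]; rewrite linearB linearZ subr_eq0 => /eqP ->.
  apply: (row_free_inj (row_base_free Q)).
  by rewrite mul0mx -mulmxA mulmx_base -scalemxAl mulmx_coker scaler0.
move=> e; have : (f x <= f b)%MS by rewrite submxE -/Q -(mulmx_base Q) mulmxA e mul0mx.
by move=> /sub_rVP[a ha]; exists a; rewrite linearB linearZ /= ha subrr.
Qed.

(** Add vectors of [B] to [A] one at a time; each addition lowers the bound. *)
Lemma kernel_in_proper m A B : linear_subspace B -> A `<=` B -> kernel_in m A ->
  A <> B -> exists2 k, (k < m)%N & kernel_in k B.
Proof.
move=> sB; elim/ltn_ind: m A => m IH A AB hA neq.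
have [b Bb nAb] : exists2 b, B b & ~ A b.
  apply: contrapT => h; apply: neq; rewrite eqEsubset; split=> // b Bb.
  by apply: contrapT => nb; apply: h; exists b.
have [m0 hA'] := kernel_in_line hA nAb.
have lt : (m.-1 < m)%N by rewrite prednK.
have [<-|neq'] := pselect ([set g | exists a, A (g - a *: b)] = B); first by exists m.-1.
have [|k km hk] := IH _ lt _ _ hA' neq'; last by exists k => //; exact: ltn_trans lt.
move=> x [a /AB Bx]; rewrite -[x](subrK (a *: b)).
by apply: subspaceD => //; exact: subspaceZ.
Qed.

Lemma kernel_in_sub m A B : linear_subspace B -> A `<=` B -> kernel_in m A ->
  exists2 k, (k <= m)%N & kernel_in k B.
Proof.
move=> sB AB hA; have [<-|neq] := pselect (A = B); first by exists m.
by have [k /ltnW] := kernel_in_proper sB AB hA neq; exists k.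
Qed.

(** The coordinates modulo [A] form a linear map, by their uniqueness. *)
Lemma has_codim_kernel A c : linear_subspace A -> has_codim A c -> kernel_in c A.
Proof.
move=> sA [v /choice[f fP]].
have uniq g (a : 'rV_c) : A (g - \sum_i a ord0 i *: v i) -> f g = a by have [_] := fP g; apply.
have [|F FE] := @linear_pack G _ f.
  move=> a x y; apply: uniq.
  have -> : \sum_i (a *: f x + f y) ord0 i *: v i =
      a *: (\sum_i f x ord0 i *: v i) + \sum_i f y ord0 i *: v i.
    rewrite scaler_sumr -big_split /=; apply: eq_bigr => i _.
    by rewrite !mxE scalerDl scalerA.
  rewrite opprD addrACA -scalerBr; apply: sA.2.
    by have [] := fP x.
  by have [] := fP y.
exists F; apply/seteqP; split=> x /=; rewrite FE.
  by move=> Ax; apply: uniq; rewrite big1 ?subr0 // => i _; rewrite mxE scale0r.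
by have [+ _] := fP x => + e; rewrite e big1 ?subr0 // => i _; rewrite mxE scale0r.
Qed.

(** Preimages of a basis of the image of [f] form a basis modulo the kernel. *)
Lemma kernel_has_codim A m : kernel_in m A -> exists2 e, (e <= m)%N & has_codim A e.
Proof.
move=> [f ->].
(* The image of f is the row space of a matrix U of largest rank among those
   whose row space is contained in the image. *)
pose good (U : 'M[K]_m) := forall x : 'rV_m, (x <= U)%MS -> exists g, f g = x.
have [k [[U [gU rU]] max]] : exists k, (exists U, good U /\ (m - \rank U)%N = k) /\
    forall k', (exists U, good U /\ (m - \rank U)%N = k') -> (k <= k')%N.
  apply: min_nat_exists; exists (m - \rank (0%R : 'M[K]_m))%N, (0%R : 'M[K]_m); split=> // x.
  by rewrite submx0 => /eqP ->; exists 0; rewrite linear0.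
have fU g : (f g <= U)%MS.
  have gV : good (U + f g)%MS.
    move=> x /sub_addsmxP[[a b] /= ->].
    have [h hE] := gU _ (submxMl a U); exists (h + b ord0 ord0 *: g).
    by rewrite linearD linearZ hE /= [b in RHS]mx11_scalar mul_scalar_mx.
  have le : (\rank (U + f g)%MS <= \rank U)%N.
    have := max _ (ex_intro _ _ (conj gV erefl)); rewrite -rU.
    by rewrite leq_sub2lE // rank_leq_row.
  apply: submx_trans (addsmxSr U (f g)) _.
  by rewrite -(geq_leqif (mxrank_leqif_sup (addsmxSl U (f g)))).
exists (\rank U); first exact: rank_leq_row.
have /choice[v vP] i : exists g, f g = row i (row_base U).
  by apply: gU; rewrite -(eq_row_base U); exact: row_sub.
exists v => g.
have fE (a : 'rV_(\rank U)) :
    f (g - \sum_i a ord0 i *: v i) = f g - a *m row_base U.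
  rewrite linearB linear_sum /= mulmx_sum_row; congr (_ - _).
  by apply: eq_bigr => i _; rewrite linearZ /= vP.
have : (f g <= row_base U)%MS by rewrite eq_row_base.
move=> /submxP[a aE]; exists a; split; first by rewrite /= fE aE subrr.
move=> b /=; rewrite fE aE => /eqP; rewrite subr_eq0 => /eqP.
exact: (row_free_inj (row_base_free U)).
Qed.

Definition finite_codim A : Prop := exists m, kernel_in m A.

Definition min_codim A : nat :=
  xget 0%N [set m | kernel_in m A /\ forall k, kernel_in k A -> (m <= k)%N].

Lemma min_codimP A : finite_codim A ->
  kernel_in (min_codim A) A /\ forall k, kernel_in k A -> (min_codim A <= k)%N.
Proof.
by move=> /min_nat_exists[m hm]; rewrite /min_codim; case: xgetP => [k _ //|/(_ m hm)].
Qed.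

(** Start with [A] itself and adjoin images not yet contained in the sum; the
codimension of the sum drops each time, so at most [m] images are added. *)
Lemma finite_codim_spanning A m : kernel_in m A ->
  exists2 s, spanning mul A s & (size s <= m.+1)%N.
Proof.
move=> hA; have sA := kernel_in_subspace hA.
suff H k s : auts mul s -> (0 < size s)%N -> kernel_in k (imsum s A) ->
    exists2 t, spanning mul A t & (size t <= size s + k)%N.
  apply: (H m [:: id]) => //; first by split; first exact: automorphism_id.
  by rewrite /= add_set0 image_id.
elim/ltn_ind: k s => k IH s hs hn hk.
have [sp|nsp] := pselect (forall psi, aut psi -> psi @` A `<=` imsum s A).
  by exists s => //; exact: leq_addr.
have [psi apsi nsub] : exists2 psi, aut psi & ~ psi @` A `<=` imsum s A.
  apply: contrapT => h; apply: nsp => psi apsi.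
  by apply: contrapT => h'; apply: h; exists psi.
have hs' : auts mul (psi :: s) by split.
have sS := imsum_subspace hs sA.
have [||k' lt hk'] := kernel_in_proper (imsum_subspace hs' sA) _ hk.
- by apply: add_subr; exact: subspace_image apsi sA.
- by move=> e; apply: nsub; rewrite e; exact: add_subl.
have [//|t ht le] := IH k' lt (psi :: s) hs' _ hk'; exists t => //.
by apply: leq_trans le _; rewrite /= addSnnS leq_add2l.
Qed.

Lemma finite_codim_large_class : large_class mul finite_codim.
Proof.
split.
- by move=> A [m]; exact: kernel_in_subspace.
- by move=> phi A aphi [m hA]; exists m; exact: kernel_in_image.
- by move=> A B [m hA] [n hB]; exists (m + n)%N; exact: kernel_in_cap.
- move=> A B [m hA] [n hB]; have sA := kernel_in_subspace hA.
  have sB := kernel_in_subspace hB.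
  have [k _ hk] := kernel_in_sub (subspace_add sA sB) (@add_subl _ _ A B sB) hA.
  by exists k.
- by move=> A [m /finite_codim_spanning[s hs _]]; exists s.
Qed.

Lemma min_codim_class (R : realType) :
  class_codim mul finite_codim (fun A => (min_codim A)%:R : R).
Proof.
split.
- move=> A B /min_codimP[hA _] fB AB; rewrite ler_nat.
  have [hB minB] := min_codimP fB.
  have [k le hk] := kernel_in_sub (kernel_in_subspace hB) AB hA.
  exact: leq_trans (minB _ hk) le.
- move=> phi A aphi /min_codimP[hA _]; rewrite ler_nat.
  have hI := kernel_in_image aphi hA.
  by have [|_ h] := @min_codimP (phi @` A); [eexists; exact: hI|exact: h].
- move=> A B /min_codimP[hA _] /min_codimP[hB _]; rewrite -natrD ler_nat.
  have hI := kernel_in_cap hA hB.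
  by have [|_ h] := @min_codimP (A `&` B); [eexists; exact: hI|exact: h].
- move=> A /min_codimP[/finite_codim_spanning[s hs le] _]; exists s => //.
  by rewrite natr1 ler_nat.
Qed.

End FiniteCodim.

Unset Implicit Arguments.
Set Strict Implicit.
Set Printing Implicit Defensive.

Theorem mainTheorem1 (R : realType) (K : fieldType) (G : lmodType K)
    (mul : {bilinear G -> G -> G}) (N : set G) (N_subspace : linear_subspace N)
    (N_large : [\/ exists c : nat, has_codim N c,
                   noeth_left_ideal mul N |
                   max_two_sided_ideal mul N]) :
  exists H : nat -> set G, forall t : nat, (1 <= t)%N ->
    (linear_subspace (H t) /\ characteristic mul (H t)) /\
    (* 1 *)
    smallest (@sublattice K G) (aut_images mul N) (H t) /\
    (* 2 *)
    (forall (n : nat) (w : free_elt K n), (n <= t)%N -> multilinear w ->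
       exists (k : nat) (phi : 'I_k -> G -> G),
         (forall i, automorphism mul (phi i)) /\
         word_set mul w (H t) `<=`
           sum_sets (fun i => phi i @` word_set mul w N)) /\
    (* 3 *)
    (forall c : nat, has_codim N c ->
       exists e : nat, has_codim (H t) e /\
         e%:R <= iter t.-1 (fun x : R => x * (x + 1)) c%:R) /\
    (noeth_left_ideal mul N ->
       forall codim : set G -> R, gen_codim (left_aut mul) codim ->
         noeth_left_ideal mul (H t) /\
         codim (H t) <= iter t.-1 (fun x : R => x * (x + 1)) (codim N)) /\
    (max_two_sided_ideal mul N ->
       forall codim : set G -> R, gen_codim (two_sided_aut mul) codim ->
         max_two_sided_ideal mul (H t) /\
         codim (H t) <= iter t.-1 (fun x : R => x * (x + 1)) (codim N)).
Proof.
pose A k := iter k (core mul) N.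
exists (fun t => orbit_sum mul (A t.-1)) => t t0.
have [C large CN] : exists2 C, large_class mul C & C N.
  case: N_large => [[c hc]|hN|hN].
  - exists (@finite_codim K G); first exact: finite_codim_large_class.
    by exists c; exact: has_codim_kernel.
  - by exists (acc_ideals (left_ideal mul)) => //; exact: (acc_large_class (left_ideal_kind mul)).
  - exists (acc_ideals (two_sided_ideal mul)) => //.
    exact: (acc_large_class (two_sided_ideal_kind mul)).
have CA := large_stage large t.-1 CN.
split; [|split; [|split; [|split; [|split]]]].
- split; last exact: (orbit_sum_characteristic large CA).
  exact: (large_subspace large (large_orbit_sum large CA)).
- move=> S [latS NS]; have [hs hn _] := large_family large CA.
  by apply: imsum_in_lattice hs hn => //; exact: stage_in_lattice large _ _ _ CN latS NS.
- by move=> n w nt wlin; apply: covered_sum_sets; exact: (word_covered large CN).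
- move=> c /(has_codim_kernel N_subspace) hN.
  have fN : finite_codim N by exists c.
  have lc := finite_codim_large_class mul.
  have [hH _] := min_codimP (large_orbit_sum lc (large_stage lc t.-1 fN)).
  have [e le he] := kernel_has_codim hH; exists e; split=> //.
  have le1 : e%:R <= (min_codim (orbit_sum mul (A t.-1)))%:R :> R by rewrite ler_nat.
  apply: le_trans le1 _.
  apply: le_trans (codim_orbit_sum_stage lc (min_codim_class mul R) t.-1 fN) _.
  have [_ /(_ c hN) leN] := min_codimP fN.
  by have /andP[_] := @iter_bound_mono R t.-1 _ c%:R (ler0n R (min_codim N))
    (etrans (ler_nat R _ _) leN).
- move=> hN codim hcodim; have lc := acc_large_class (left_ideal_kind mul).
  split; first exact: (large_orbit_sum lc (large_stage lc t.-1 hN)).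
  exact: (codim_orbit_sum_stage lc (gen_codim_class hcodim)).
- move=> hN codim hcodim; have lc := acc_large_class (two_sided_ideal_kind mul).
  split; first exact: (large_orbit_sum lc (large_stage lc t.-1 hN)).
  exact: (codim_orbit_sum_stage lc (gen_codim_class hcodim)).
Qed.
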